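(* Let $(A,\cdot,\{\,,\,,\,\})$ be a Nambu-Poisson algebra and $N:A\to A$ be a Nijenhuis operator on it. Then the triple $A_N=(A,\cdot_N,\{\,,\,,\,\}_N)$ is a Nambu-Poisson algebra, where $$a\cdot_N b:=N(a)\cdot b+a\cdot N(b)-N(a\cdot b),$$ $$\{a,b,c\}_N:=\{N(a),N(b),c\}+\{N(a),b,N(c)\}+\{a,N(b),N(c)\}-N\big(\{N(a),b,c\}+\{a,N(b),c\}+\{a,b,N(c)\}-N\{a,b,c\}\big),$$ for $a,b,c\in A$. Moreover, $N:A_N\to A$ is a homomorphism of Nambu-Poisson algebras.
   Context: All vector spaces and (multi)linear maps are over a field $k$ of characteristic $0$. A 3-Lie algebra is a vector space $\mathcal L$ with a skew-symmetric trilinear operation $\{\,,\,,\,\}$ satisfying $\{a,b,\{c,d,e\}\}=\{\{a,b,c\},d,e\}+\{c,\{a,b,d\},e\}+\{c,d,\{a,b,e\}\}$. A Nambu-Poisson algebra $(A,\cdot,\{\,,\,,\,\})$ is a commutative associative algebra $(A,\cdot)$ (not assumed unital) together with a 3-Lie algebra structure $\{\,,\,,\,\}$ on $A$ such that $\{a,b,c\cdot d\}=\{a,b,c\}\cdot d+c\cdot\{a,b,d\}$ for all $a,b,c,d\in A$. A homomorphism of Nambu-Poisson algebras is a linear map preserving both operations. A linear map $N:A\to A$ is a Nijenhuis operator on $A$ if for all $a,b,c\in A$: $N(a)\cdot N(b)=N\big(N(a)\cdot b+a\cdot N(b)-N(a\cdot b)\big)$ and $\{N(a),N(b),N(c)\}=N\Big(\{N(a),N(b),c\}+\{N(a),b,N(c)\}+\{a,N(b),N(c)\}-N\big(\{N(a),b,c\}+\{a,N(b),c\}+\{a,b,N(c)\}-N\{a,b,c\}\big)\Big)$.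 *)

(* Defs.v *)
From mathcomp Require Import all_boot all_algebra.

Set Implicit Arguments.
Unset Strict Implicit.
Unset Printing Implicit Defensive.

Import GRing.Theory.
Local Open Scope ring_scope.

(* Structures are predicates on bare operations rather than canonical instances
   on the carrier: two structures on the same vector space have to coexist, and
   the algebras are not unital, so they are not MathComp rings. *)

Record is_comm_assoc_algebra (k : fieldType) (A : lmodType k)
    (mul : A -> A -> A) : Prop := {
  ca_linearl : forall b, linear (fun a => mul a b);
  ca_linearr : forall a, linear (fun b => mul a b);
  ca_comm : forall a b, mul a b = mul b a;
  ca_assoc : forall a b c, mul a (mul b c) = mul (mul a b) c
}.

Record is_3Lie_algebra (k : fieldType) (L : lmodType k)
    (br : L -> L -> L -> L) : Prop := {
  tl_linear1 : forall b c, linear (fun a => br a b c);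
  tl_linear2 : forall a c, linear (fun b => br a b c);
  tl_linear3 : forall a b, linear (fun c => br a b c);
  tl_skew12 : forall a b c, br b a c = - br a b c;
  tl_skew23 : forall a b c, br a c b = - br a b c;
  tl_skew13 : forall a b c, br c b a = - br a b c;
  tl_fundamental : forall a b c d e,
    br a b (br c d e)
      = br (br a b c) d e + br c (br a b d) e + br c d (br a b e)
}.

Record is_Nambu_Poisson_algebra (k : fieldType) (A : lmodType k)
    (mul : A -> A -> A) (br : A -> A -> A -> A) : Prop := {
  np_mul : is_comm_assoc_algebra mul;
  np_br : is_3Lie_algebra br;
  np_leibniz : forall a b c d,
    br a b (mul c d) = mul (br a b c) d + mul c (br a b d)
}.

Record is_Nambu_Poisson_hom (k : fieldType) (A B : lmodType k)
    (mulA : A -> A -> A) (brA : A -> A -> A -> A)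
    (mulB : B -> B -> B) (brB : B -> B -> B -> B) (f : A -> B) : Prop := {
  nph_linear : linear f;
  nph_mul : forall a b, f (mulA a b) = mulB (f a) (f b);
  nph_br : forall a b c, f (brA a b c) = brB (f a) (f b) (f c)
}.

Definition deformed_mul (k : fieldType) (A : lmodType k)
    (mul : A -> A -> A) (N : A -> A) (a b : A) : A :=
  mul (N a) b + mul a (N b) - N (mul a b).

Definition deformed_br (k : fieldType) (A : lmodType k)
    (br : A -> A -> A -> A) (N : A -> A) (a b c : A) : A :=
  br (N a) (N b) c + br (N a) b (N c) + br a (N b) (N c)
  - N (br (N a) b c + br a (N b) c + br a b (N c) - N (br a b c)).

Record is_Nijenhuis (k : fieldType) (A : lmodType k)
    (mul : A -> A -> A) (br : A -> A -> A -> A) (N : A -> A) : Prop := {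
  nij_linear : linear N;
  nij_mul : forall a b,
    mul (N a) (N b) = N (mul (N a) b + mul a (N b) - N (mul a b));
  nij_br : forall a b c,
    br (N a) (N b) (N c)
      = N (br (N a) (N b) c + br (N a) b (N c) + br a (N b) (N c)
           - N (br (N a) b c + br a (N b) c + br a b (N c) - N (br a b c)))
}.

(* Main.v *)
(* [N + s] is again a Nijenhuis operator for every scalar [s], and it maps the
   operations deformed by [N + s] to the original ones. Hence the defect [J s] of
   each Nambu-Poisson identity for those deformed operations satisfies
   [(N + s) (J s) = 0] for all [s]. As [J] is polynomial in [s], [k] is infinite,
   and [N + s] is monic in [s], this forces [J = 0]; the identities for [N] are
   the case [s = 0]. *)

Require Import Defs.
From HB Require Import structures.
From mathcomp Require Import all_boot all_algebra.
From mathcomp Require Import ring.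

Set Implicit Arguments.
Unset Strict Implicit.
Unset Printing Implicit Defensive.

Import GRing.Theory.
Local Open Scope ring_scope.

(** * The square-zero extension of a field by a vector space *)

Section SquareZeroExtension.
Variables (k : fieldType) (A : lmodType k).

Definition sqzero : Type := (k * A)%type.

HB.instance Definition _ := GRing.Zmodule.on sqzero.

(** The pair [(c, u)] stands for the sum of the scalar [c] and the vector [u]; products of two
    vectors are set to zero. *)
Definition sqzero_mul (x y : sqzero) : sqzero :=
  (x.1 * y.1, x.1 *: y.2 + y.1 *: x.2).

Fact sqzero_mulA : associative sqzero_mul.
Proof.
move=> [a u] [b v] [c w]; rewrite /sqzero_mul /= mulrA.
by rewrite !scalerDr !scalerA addrA (mulrC c a) (mulrC c b).
Qed.

Fact sqzero_mulC : commutative sqzero_mul.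
Proof. by move=> x y; rewrite /sqzero_mul mulrC addrC. Qed.

Fact sqzero_mul1 : left_id ((1, 0) : sqzero) sqzero_mul.
Proof. by move=> [a u]; rewrite /sqzero_mul /= mul1r scale1r scaler0 addr0. Qed.

Fact sqzero_mulDl : left_distributive sqzero_mul +%R.
Proof.
move=> [a u] [b v] [c w]; congr (_, _) => /=; first by rewrite mulrDl.
by rewrite scalerDl scalerDr addrACA.
Qed.

Fact sqzero_1neq0 : ((1, 0) : sqzero) != 0.
Proof. by rewrite xpair_eqE oner_eq0. Qed.

HB.instance Definition _ := GRing.Zmodule_isComNzRing.Build sqzero
  sqzero_mulA sqzero_mulC sqzero_mul1 sqzero_mulDl sqzero_1neq0.

Definition sqz_vec (u : A) : sqzero := (0, u).
Definition sqz_scal (c : k) : sqzero := (c, 0).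

Lemma sqz_vec_inj : injective sqz_vec.
Proof. by move=> u v []. Qed.

Lemma sqz_vec0 : sqz_vec 0 = 0.
Proof. by []. Qed.

Lemma sqz_vecD u v : sqz_vec (u + v) = sqz_vec u + sqz_vec v.
Proof. by congr (_, _); rewrite /= addr0. Qed.

Lemma sqz_vecN u : sqz_vec (- u) = - sqz_vec u.
Proof. by congr (_, _); rewrite /= oppr0. Qed.

Lemma sqz_vecZ c u : sqz_vec (c *: u) = sqz_scal c * sqz_vec u.
Proof. by congr (_, _); rewrite /= ?mulr0 // scale0r addr0. Qed.

Definition sqz_vecE := (sqz_vec0, sqz_vecD, sqz_vecN, sqz_vecZ).

End SquareZeroExtension.

(* In the square-zero extension [k x A], identities between linear combinations
   of vectors become identities in a commutative ring. *)
Ltac module_ring := apply: sqz_vec_inj; rewrite !sqz_vecE; ring.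

(** * Rewriting rules for maps that are linear in the sense of a predicate *)

Section LinearPredicate.
Variables (k : fieldType) (U V : lmodType k) (f : U -> V).
Hypothesis lin_f : linear f.

Lemma linear_addE u v : f (u + v) = f u + f v.
Proof. by rewrite -[u]scale1r lin_f !scale1r. Qed.

Lemma linear_zeroE : f 0 = 0.
Proof. by apply: (addrI (f 0)); rewrite -linear_addE !addr0. Qed.

Lemma linear_scaleE c u : f (c *: u) = c *: f u.
Proof. by rewrite -[c *: u]addr0 lin_f linear_zeroE addr0. Qed.

Lemma linear_oppE u : f (- u) = - f u.
Proof. by rewrite -scaleN1r linear_scaleE scaleN1r. Qed.

End LinearPredicate.

(** * Vector-valued polynomial functions of a scalar *)

Section PolynomialMaps.
Variable k : fieldType.

(** Horner form makes the closure properties structural inductions, with no degrees to track. The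
    equations are pointwise, so that no functional extensionality is required. *)
Inductive poly_map (V : lmodType k) : (k -> V) -> Prop :=
| poly_map_cst v f : (forall t, f t = v) -> poly_map f
| poly_map_horner v g f :
    poly_map g -> (forall t, f t = v + t *: g t) -> poly_map f.

Lemma poly_map_add (V : lmodType k) (f g : k -> V) :
  poly_map f -> poly_map g -> poly_map (fun t => f t + g t).
Proof.
move=> pf; elim: pf g => {f} [v f fE|v f' f pf' IH fE] g.
  case=> {g} [w g gE|w g' g pg' gE].
    by apply: (@poly_map_cst _ (v + w)) => t; rewrite fE gE.
  by apply: (poly_map_horner (v := v + w) pg') => t; rewrite fE gE addrA.
case=> {g} [w g gE|w g' g pg' gE].
  by apply: (poly_map_horner (v := v + w) pf') => t; rewrite fE gE addrAC.
apply: (poly_map_horner (v := v + w) (IH _ pg')) => t.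
by rewrite fE gE scalerDr addrACA.
Qed.

Lemma poly_map_scale (V : lmodType k) (f : k -> V) :
  poly_map f -> poly_map (fun t => t *: f t).
Proof. by move=> pf; apply: (poly_map_horner (v := 0) pf) => t; rewrite add0r. Qed.

Lemma poly_map_linear (U V : lmodType k) (L : U -> V) (f : k -> U) :
  linear L -> poly_map f -> poly_map (fun t => L (f t)).
Proof.
move=> linL; elim=> {f} [v f fE|v f' f pf' IH fE].
  by apply: (@poly_map_cst _ (L v)) => t; rewrite fE.
apply: (poly_map_horner (v := L v) IH) => t.
by rewrite fE linear_addE // linear_scaleE.
Qed.

Lemma poly_map_opp (V : lmodType k) (f : k -> V) :
  poly_map f -> poly_map (fun t => - f t).
Proof.
by apply: poly_map_linear => c u v; rewrite opprD scalerN.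
Qed.

Lemma eq_poly_map (V : lmodType k) (f g : k -> V) :
  f =1 g -> poly_map f -> poly_map g.
Proof.
move=> + pf; case: pf => {f} [v f fE|v f' f pf fE] fg.
  by apply: (@poly_map_cst _ v) => t; rewrite -fg.
by apply: (poly_map_horner (v := v) pf) => t; rewrite -fg.
Qed.

(** Horner induction on [f]: for [f t = v + t *: f' t] the value splits into [B v (g t)], polynomial
    by linearity in the second argument, and [t *: B (f' t) (g t)]. *)
Lemma poly_map_bilinear (U V W : lmodType k) (B : U -> V -> W) f g :
    (forall v, linear (B^~ v)) -> (forall u, linear (B u)) ->
  poly_map f -> poly_map g -> poly_map (fun t => B (f t) (g t)).
Proof.
move=> linl linr + pg; elim=> {f} [v f fE|v f' f pf' IH fE].
  apply: (eq_poly_map (f := fun t => B v (g t))) => [t|]; first by rewrite fE.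
  exact: poly_map_linear.
apply: (eq_poly_map (f := fun t => B v (g t) + t *: B (f' t) (g t))) => [t|].
  by rewrite fE (linear_addE (linl _)) (linear_scaleE (linl _)).
by apply: poly_map_add; [apply: poly_map_linear|apply: poly_map_scale].
Qed.

Lemma poly_map_trilinear (U V W X : lmodType k) (B : U -> V -> W -> X) f g h :
    (forall v w, linear (fun u => B u v w)) ->
    (forall u w, linear (fun v => B u v w)) ->
    (forall u v, linear (fun w => B u v w)) ->
  poly_map f -> poly_map g -> poly_map h ->
  poly_map (fun t => B (f t) (g t) (h t)).
Proof.
move=> lin1 lin2 lin3; move=> + pg ph; elim=> {f} [v f fE|v f' f pf' IH fE].
  apply: (eq_poly_map (f := fun t => B v (g t) (h t))) => [t|].
    by rewrite fE.
  exact: poly_map_bilinear.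
apply: (eq_poly_map
  (f := fun t => B v (g t) (h t) + t *: B (f' t) (g t) (h t))) => [t|].
  by rewrite fE (linear_addE (lin1 _ _)) (linear_scaleE (lin1 _ _)).
by apply: poly_map_add; [apply: poly_map_bilinear|apply: poly_map_scale].
Qed.

Lemma poly_map_coefs (V : lmodType k) (f : k -> V) : poly_map f ->
  exists n (u : nat -> V), (forall i, (n <= i)%N -> u i = 0) /\
    forall t, f t = \sum_(i < n) t ^+ i *: u i.
Proof.
elim=> {f} [v f fE|v f' f _ [n [u [u0 f'E]]] fE].
  exists 1%N, (fun i => if i is 0%N then v else 0); split; first by case.
  by move=> t; rewrite fE big_ord1 scale1r.
exists n.+1, (fun i => if i is j.+1 then u j else v).
split; first by case=> // i /u0.
move=> t; rewrite fE f'E big_ord_recl scale1r scaler_sumr; congr (_ + _).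
by apply: eq_bigr => i _; rewrite scalerA -exprS.
Qed.

Hypothesis char0 : [pchar k] =i pred0.

Lemma vanishing_poly_coefs (V : lmodType k) n (u : nat -> V) :
    (forall t : k, \sum_(i < n) t ^+ i *: u i = 0) ->
  forall i, (i < n)%N -> u i = 0.
Proof.
elim: n u => // n IH u u0.
(* [f (2 t) - 2 ^ n f t] has no term of degree [n], and its other coefficients
   are nonzero multiples of those of [f]. *)
have low i : (i < n)%N -> u i = 0.
  move=> lt_in; have vanish t :
      \sum_(i < n) t ^+ i *: ((2 ^+ n - 2 ^+ i) *: u i) = 0.
    have: 2 ^+ n *: (\sum_(i < n.+1) t ^+ i *: u i)
        = \sum_(i < n.+1) (2 * t) ^+ i *: u i by rewrite !u0 scaler0.
    rewrite !big_ord_recr /= scalerDr scalerA -exprMn => /addIr/eqP.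
    rewrite -subr_eq0 scaler_sumr -sumrB => /eqP sum0; rewrite -[RHS]sum0.
    apply: eq_bigr => j _.
    by rewrite !scalerA -scalerBl exprMn mulrBr (mulrC (t ^+ j)) [t ^+ j * _]mulrC.
  (* The factor [2 ^+ n - 2 ^+ i] is the image of a positive natural number, hence nonzero in
     characteristic 0. *)
  have /eqP := IH (fun i => (2 ^+ n - 2 ^+ i) *: u i) vanish i lt_in.
  rewrite scaler_eq0 -!natrX -natrB ?leq_exp2l ?(ltnW lt_in) //.
  rewrite ((pcharf0P k).1 char0) subn_eq0 leqNgt ltn_exp2l // lt_in /=.
  by move/eqP.
move=> i; rewrite ltnS leq_eqVlt => /predU1P[->|/low //].
(* With the lower coefficients gone, evaluation at 1 isolates the top one. *)
have := u0 1; rewrite big_ord_recr big1 /= => [|j _]; last by rewrite low ?scaler0.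
by rewrite add0r expr1n scale1r.
Qed.

(** Comparing coefficients gives [N (u i.+1) + u i = 0], so each coefficient of [f] vanishes once
    the next one does; the descent starts above the degree. *)
Lemma shift_torsion_poly_map (V : lmodType k) (N : V -> V) (f : k -> V) :
    linear N -> poly_map f -> (forall t, N (f t) + t *: f t = 0) ->
  forall t, f t = 0.
Proof.
move=> linN /poly_map_coefs[n [u [u0 fE]]] Nf t.
(* [w i] is the coefficient of [t ^+ i] in [N (f t) + t *: f t]. Multiplication by [t] raises the
   degree by one, hence the bound [n.+1] below and the default 0 at index 0. *)
pose w i := N (u i) + if i is j.+1 then u j else 0.
have w0 : forall i, (i < n.+1)%N -> w i = 0.
  apply: vanishing_poly_coefs => s; rewrite -[RHS](Nf s) fE.
  rewrite /w; under eq_bigr do rewrite scalerDr; rewrite big_split /=.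
  congr (_ + _).
    rewrite big_ord_recr /= u0 // (linear_zeroE linN) scaler0 addr0.
    elim: n {u0 fE w} => [|m IH]; first by rewrite !big_ord0 (linear_zeroE linN).
    by rewrite !big_ord_recr /= IH (linear_addE linN) (linear_scaleE linN).
  rewrite big_ord_recl scaler0 add0r scaler_sumr.
  by apply: eq_bigr => i _; rewrite scalerA -exprS.
(* Descending induction on the index, written as [n - j]. Once [n <= j], truncated subtraction makes
   [n - j] and [n - j.+1] both 0, and the induction hypothesis suffices. *)
have {}u0 j : u (n - j)%N = 0.
  elim: j => [|j IH]; first by rewrite subn0 u0.
  case: (ltnP j n) => [lt_jn|]; last first.
    by move=> le_nj; move: IH (le_nj) (leqW le_nj); rewrite -!subn_eq0 => IH
      /eqP n_j /eqP ->; rewrite -n_j.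
  have := w0 (n - j)%N; rewrite ltnS leq_subr /w IH (linear_zeroE linN) add0r.
  by rewrite -{1}(prednK (n := n - j)) ?subn_gt0 // -subnS; apply.
rewrite fE big1 // => i _.
by rewrite -(subKn (ltnW (ltn_ord i))) u0 scaler0.
Qed.

End PolynomialMaps.

(** * Deformed operations: linearity, symmetry and dependence on the shift *)

Section Deformation.
Variables (k : fieldType) (A : lmodType k).
Variables (mul : A -> A -> A) (br : A -> A -> A -> A).
Hypothesis hA : is_Nambu_Poisson_algebra mul br.

Let mulP := np_mul hA.
Let brP := np_br hA.

Let mulE :=
  (fun b => linear_addE (ca_linearl mulP b),
   fun b => linear_oppE (ca_linearl mulP b),
   fun b => linear_scaleE (ca_linearl mulP b),
   fun a => linear_addE (ca_linearr mulP a),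
   fun a => linear_oppE (ca_linearr mulP a),
   fun a => linear_scaleE (ca_linearr mulP a)).

Let brE :=
  (fun b c => linear_addE (tl_linear1 brP b c),
   fun b c => linear_oppE (tl_linear1 brP b c),
   fun b c => linear_scaleE (tl_linear1 brP b c),
   (fun a c => linear_addE (tl_linear2 brP a c),
    fun a c => linear_oppE (tl_linear2 brP a c),
    fun a c => linear_scaleE (tl_linear2 brP a c)),
   (fun a b => linear_addE (tl_linear3 brP a b),
    fun a b => linear_oppE (tl_linear3 brP a b),
    fun a b => linear_scaleE (tl_linear3 brP a b))).

Definition shift (N : A -> A) (s : k) (a : A) : A := N a + s *: a.

Lemma shift0 N : shift N 0 =1 N.
Proof. by move=> a; rewrite /shift scale0r addr0. Qed.

Lemma linear_shift N s : linear N -> linear (shift N s).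
Proof. move=> linN c u v; rewrite /shift linN; module_ring. Qed.

Lemma eq_deformed_mul N N' : N =1 N' -> deformed_mul mul N =2 deformed_mul mul N'.
Proof. by move=> eqN a b; rewrite /deformed_mul !eqN. Qed.

Lemma eq_deformed_br N N' a b c :
  N =1 N' -> deformed_br br N a b c = deformed_br br N' a b c.
Proof. by move=> eqN; rewrite /deformed_br !eqN. Qed.

Lemma deformed_mul_linearl N b :
  linear N -> linear (fun a => deformed_mul mul N a b).
Proof.
move=> linN c u v; rewrite /deformed_mul.
rewrite !(mulE, linear_addE linN, linear_scaleE linN); module_ring.
Qed.

Lemma deformed_mulC N a b : deformed_mul mul N b a = deformed_mul mul N a b.
Proof.
by rewrite /deformed_mul !(ca_comm mulP b) !(ca_comm mulP (N b)) [mul a _ + _]addrC.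
Qed.

Lemma deformed_mul_linearr N a : linear N -> linear (deformed_mul mul N a).
Proof.
by move=> linN c u v; rewrite !(deformed_mulC _ _ a); apply: deformed_mul_linearl.
Qed.

Lemma deformed_br_linear1 N b c :
  linear N -> linear (fun a => deformed_br br N a b c).
Proof.
move=> linN s u v; rewrite /deformed_br.
rewrite !(brE, linear_addE linN, linear_scaleE linN, linear_oppE linN).
module_ring.
Qed.

Lemma deformed_br_skew12 N a b c :
  linear N -> deformed_br br N b a c = - deformed_br br N a b c.
Proof.
(* Fixing one argument keeps the repeated rewrite from looping: only brackets with [b] or [N b] in
   the second slot are flipped. *)
move=> linN; rewrite /deformed_br !(tl_skew12 brP b) !(tl_skew12 brP (N b)).
rewrite !(linear_addE linN, linear_oppE linN); module_ring.
Qed.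

Lemma deformed_br_skew23 N a b c :
  linear N -> deformed_br br N a c b = - deformed_br br N a b c.
Proof.
move=> linN; rewrite /deformed_br !(fun a => tl_skew23 brP a b).
rewrite !(fun a => tl_skew23 brP a (N b)).
rewrite !(linear_addE linN, linear_oppE linN); module_ring.
Qed.

Lemma deformed_br_skew13 N a b c :
  linear N -> deformed_br br N c b a = - deformed_br br N a b c.
Proof.
move=> linN; rewrite deformed_br_skew12 // deformed_br_skew23 //.
by rewrite deformed_br_skew12 // opprK.
Qed.

Lemma deformed_br_linear2 N a c :
  linear N -> linear (fun b => deformed_br br N a b c).
Proof.
move=> linN s u v; rewrite !(deformed_br_skew12 _ a) //.
by rewrite deformed_br_linear1 // opprD scalerN.
Qed.

Lemma deformed_br_linear3 N a b : linear N -> linear (deformed_br br N a b).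
Proof.
move=> linN s u v; rewrite !(fun c => deformed_br_skew23 a c b linN).
by rewrite deformed_br_linear2 // opprD scalerN.
Qed.

(** Write each condition as the vanishing of a product of commuting differences, one per slot: [N]
    applied in that slot minus [N] applied to the result. Adding a scalar to [N] changes none of
    these differences. *)
Lemma shift_Nijenhuis N s :
  is_Nijenhuis mul br N -> is_Nijenhuis mul br (shift N s).
Proof.
case=> linN Nmul Nbr; split; first exact: linear_shift.
  move=> a b; rewrite /shift.
  rewrite !(mulE, linear_addE linN, linear_scaleE linN, linear_oppE linN).
  rewrite Nmul !(linear_addE linN, linear_scaleE linN, linear_oppE linN).
  module_ring.
move=> a b c; rewrite /shift.
rewrite !(brE, linear_addE linN, linear_scaleE linN, linear_oppE linN).
rewrite Nbr !(linear_addE linN, linear_scaleE linN, linear_oppE linN).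
module_ring.
Qed.

Lemma poly_map_shift N f :
  linear N -> poly_map f -> poly_map (fun t => shift N t (f t)).
Proof.
move=> linN pf.
by apply: poly_map_add; [apply: poly_map_linear|apply: poly_map_scale].
Qed.

Lemma poly_map_mul f g :
  poly_map f -> poly_map g -> poly_map (fun t => mul (f t) (g t)).
Proof.
exact: poly_map_bilinear (ca_linearl mulP) (ca_linearr mulP).
Qed.

Lemma poly_map_br f g h : poly_map f -> poly_map g -> poly_map h ->
  poly_map (fun t => br (f t) (g t) (h t)).
Proof.
exact: poly_map_trilinear (tl_linear1 brP) (tl_linear2 brP) (tl_linear3 brP).
Qed.

Lemma poly_map_deformed_mul N f g : linear N -> poly_map f -> poly_map g ->
  poly_map (fun t => deformed_mul mul (shift N t) (f t) (g t)).
Proof.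
move=> linN pf pg; have shiftP := poly_map_shift linN.
apply: poly_map_add; last by apply: poly_map_opp; apply/shiftP/poly_map_mul.
by apply: poly_map_add; apply: poly_map_mul => //; apply: shiftP.
Qed.

Lemma poly_map_deformed_br N f g h :
    linear N -> poly_map f -> poly_map g -> poly_map h ->
  poly_map (fun t => deformed_br br (shift N t) (f t) (g t) (h t)).
Proof.
move=> linN pf pg ph; have shiftP := poly_map_shift linN.
have [pbr pNf pNg pNh] := And4 poly_map_br (shiftP _ pf) (shiftP _ pg) (shiftP _ ph).
apply: poly_map_add.
  by apply: poly_map_add; [apply: poly_map_add|]; apply: pbr.
apply/poly_map_opp/shiftP/poly_map_add; last exact/poly_map_opp/shiftP/pbr.
by apply: poly_map_add; [apply: poly_map_add|]; apply: pbr.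
Qed.

(** * Cancellation of the shift, and the identities of the deformed operations *)

Hypothesis char0 : [pchar k] =i pred0.
Variable N : A -> A.
Hypothesis hN : is_Nijenhuis mul br N.

Let linN := nij_linear hN.
Let linT t := linear_shift t linN.

Lemma shift_deformed_mul t a b :
  shift N t (deformed_mul mul (shift N t) a b) = mul (shift N t a) (shift N t b).
Proof. by rewrite (nij_mul (shift_Nijenhuis t hN)). Qed.

Lemma shift_deformed_br t a b c :
  shift N t (deformed_br br (shift N t) a b c) =
  br (shift N t a) (shift N t b) (shift N t c).
Proof. by rewrite (nij_br (shift_Nijenhuis t hN)). Qed.

(** A single [shift N t] may have a kernel, but the polynomial difference [f t - g t] is killed by
    [shift N t] for every [t], so [shift_torsion_poly_map] applies. *)
Lemma eq_of_shift (f g : k -> A) : poly_map f -> poly_map g ->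
  (forall t, shift N t (f t) = shift N t (g t)) -> f =1 g.
Proof.
move=> pf pg fg t; apply/eqP; rewrite -subr_eq0; apply/eqP; move: t.
apply: (shift_torsion_poly_map char0 linN) => [|t].
  exact/poly_map_add/poly_map_opp.
by rewrite -[LHS]/(shift N t _) (linear_addE (linT t)) fg
  (linear_oppE (linT t)) subrr.
Qed.

Let cstP (v : A) : poly_map (fun _ : k => v).
Proof. exact: poly_map_cst. Qed.

(** Stated for all [t] because cancellation uses the whole family. Under [shift N t] both sides
    become triple products of shifted elements for [mul], where associativity is known; the next two
    identities follow the same scheme. *)
Lemma deformed_mulA t a b c :
  let m := deformed_mul mul (shift N t) in m a (m b c) = m (m a b) c.
Proof.
move=> m; rewrite {}/m; move: t; have pm := poly_map_deformed_mul linN.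
apply: eq_of_shift => [||t].
- exact: pm (cstP a) (pm _ _ (cstP b) (cstP c)).
- exact: pm (pm _ _ (cstP a) (cstP b)) (cstP c).
by rewrite !shift_deformed_mul (ca_assoc mulP).
Qed.

Lemma deformed_br_fundamental t a b c d e :
  let B := deformed_br br (shift N t) in
  B a b (B c d e) = B (B a b c) d e + B c (B a b d) e + B c d (B a b e).
Proof.
move=> B; rewrite {}/B; move: t; have pB := poly_map_deformed_br linN.
apply: eq_of_shift => [||t].
- exact: pB (cstP a) (cstP b) (pB _ _ _ (cstP c) (cstP d) (cstP e)).
- have pab x := pB _ _ _ (cstP a) (cstP b) (cstP x).
  apply: poly_map_add; last exact: pB (cstP c) (cstP d) (pab e).
  apply: poly_map_add; first exact: pB (pab c) (cstP d) (cstP e).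
  exact: pB (cstP c) (pab d) (cstP e).
by rewrite shift_deformed_br 2!(linear_addE (linT t)) !shift_deformed_br (tl_fundamental brP).
Qed.

Lemma deformed_leibniz t a b c d :
  let m := deformed_mul mul (shift N t) in
  let B := deformed_br br (shift N t) in
  B a b (m c d) = m (B a b c) d + m c (B a b d).
Proof.
move=> m B; rewrite {}/m {}/B; move: t.
have pm := poly_map_deformed_mul linN; have pB := poly_map_deformed_br linN.
apply: eq_of_shift => [||t].
- exact: pB (cstP a) (cstP b) (pm _ _ (cstP c) (cstP d)).
- have pab x := pB _ _ _ (cstP a) (cstP b) (cstP x).
  by apply: poly_map_add; [exact: pm (pab c) (cstP d)|exact: pm (cstP c) (pab d)].
rewrite shift_deformed_br (linear_addE (linT t)).
rewrite !(shift_deformed_br, shift_deformed_mul).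
by rewrite (np_leibniz hA).
Qed.

End Deformation.

Theorem theorem3p14 (k : fieldType) (char0 : [pchar k] =i pred0)
    (A : lmodType k) (mul : A -> A -> A) (br : A -> A -> A -> A) (N : A -> A)
    (hA : is_Nambu_Poisson_algebra mul br) (hN : is_Nijenhuis mul br N) :
  is_Nambu_Poisson_algebra (deformed_mul mul N) (deformed_br br N) /\
  is_Nambu_Poisson_hom (deformed_mul mul N) (deformed_br br N) mul br N.
Proof.
have [linN Nmul Nbr] := hN.
(* [shift N 0] agrees with [N] only pointwise, so the identities at [t = 0] are transported along
   these equations. *)
have mE := eq_deformed_mul mul (shift0 N).
have BE a b c := eq_deformed_br br a b c (shift0 N).
(* Preservation of the operations by [N] is exactly the pair of Nijenhuis conditions. *)
split; last by split=> // *; rewrite (Nmul, Nbr).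
split; first split.
- by move=> b; apply: (deformed_mul_linearl hA).
- by move=> a; apply: (deformed_mul_linearr hA).
- by move=> a b; apply: (deformed_mulC hA).
- by move=> a b c; rewrite -!mE (deformed_mulA hA char0 hN).
- split=> [b c|a c|a b|a b c|a b c|a b c|a b c d e].
  + exact: (deformed_br_linear1 hA).
  + exact: (deformed_br_linear2 hA).
  + exact: (deformed_br_linear3 hA).
  + exact: (deformed_br_skew12 hA).
  + exact: (deformed_br_skew23 hA).
  + exact: (deformed_br_skew13 hA).
  by rewrite -!BE (deformed_br_fundamental hA char0 hN).
by move=> a b c d; rewrite -!mE -!BE (deformed_leibniz hA char0 hN).
Qed.
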